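(* Let $B$ be an associative $\Bbbk$-algebra, let $q,\gamma_1,\gamma_2\in\Bbbk$ and $\gamma=\gamma_1\gamma_2(1-q)$, and let $k\ge 1$ be an integer. Let $z_1,\ldots,z_{2k+1},w_1,\ldots,w_k\in B$ be such that for all $1\le i<j\le 2k+1$ $$z_iz_j=\begin{cases} q z_jz_i+w_i,& \text{if } i+j=2k+2,\\ q z_jz_i,&\text{if } i+j\ne 2k+2.\end{cases}$$ Set $u_k=z_1+\cdots+z_k+\gamma_1z_{k+1}$ and $v_k=\gamma_2z_{k+1}+z_{k+2}+\cdots+z_{2k+1}$. If $\sum_{i=1}^k w_i=-\gamma z_{k+1}^2$, then $$u_kv_k=q\,v_ku_k.$$ In particular, if moreover $q$ is a primitive root of unity of order $n$ and $\gamma_1+\gamma_2=1$, then $$(z_1+\cdots+z_{2k+1})^n=z_1^n+\cdots+z_k^n+(\gamma_1^n+\gamma_2^n)z_{k+1}^n+z_{k+2}^n+\cdots+z_{2k+1}^n.$$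
   Context: $\Bbbk$ is an algebraically closed field of characteristic $0$. *)

(* Defs.v *)
From HB Require Import structures.
From mathcomp Require Import all_boot all_algebra.

Set Implicit Arguments.
Unset Strict Implicit.
Unset Printing Implicit Defensive.

Import GRing.Theory.
Local Open Scope ring_scope.

(* A finite family z_1, ..., z_m is a function z : nat -> B of which only the
   values at indices 1, ..., m are used. *)

Definition u_elt (F : closedFieldType) (B : algType F) (gamma1 : F) (k : nat)
    (z : nat -> B) : B :=
  \sum_(1 <= i < k.+1) z i + gamma1 *: z k.+1.

Definition v_elt (F : closedFieldType) (B : algType F) (gamma2 : F) (k : nat)
    (z : nat -> B) : B :=
  gamma2 *: z k.+1 + \sum_(k.+2 <= i < (2 * k + 1).+1) z i.

(* Main.v *)
Require Import Defs.
From HB Require Import structures.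
From mathcomp Require Import all_boot all_algebra.
From mathcomp Require Import ring zify.

Set Implicit Arguments.
Unset Strict Implicit.
Unset Printing Implicit Defensive.

Import GRing.Theory.
Local Open Scope ring_scope.

(** Say that x and y q-commute when x y = q y x.

    For the first claim, write u_k = S + gamma1 c and v_k = gamma2 c + T, with
    S and T the sums of the outer z_i and c = z_(k+1).  The hypotheses make S
    q-commute with c, and c with T; in S T each z_i with i <= k meets exactly
    one partner z_(2k+2-i), so S T = q T S + w_1 + ... + w_k.  Expanding
    u_k v_k, the only defects of q-commutation are the sum of the w_i and
    gamma1 gamma2 (1 - q) c^2 = gamma c^2, and these cancel by hypothesis
    ([qcommD_defect]).

    For the second claim, when q is a primitive n-th root of unity the middle
    Gaussian binomials of order n vanish at q ([qbinom_prim_root]), so the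
    q-binomial theorem ([qbinomial]) says that n-th powers are additive on
    q-commuting pairs ([exprDn_qcomm]) and, by induction, on sums of pairwise
    q-commuting elements ([expr_sum_qcomm]).
    As gamma1 + gamma2 = 1, the sum of all z_i is u_k + v_k, which splits first
    as u_k^n + v_k^n; no paired indices i + j = 2k+2 occur inside u_k or inside
    v_k, so each of these splits further into its individual n-th powers. *)

Fixpoint qbinom (R : comNzRingType) (q : R) (m i : nat) : R :=
  match m, i with
  | _, 0 => 1
  | 0, _.+1 => 0
  | m'.+1, i'.+1 => qbinom q m' i' + q ^+ i'.+1 * qbinom q m' i'.+1
  end.

Lemma qbinom0 (R : comNzRingType) (q : R) (m : nat) : qbinom q m 0 = 1.
Proof. by case: m. Qed.

Lemma qbinomS (R : comNzRingType) (q : R) (m i : nat) :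
  qbinom q m.+1 i.+1 = qbinom q m i + q ^+ i.+1 * qbinom q m i.+1.
Proof. by []. Qed.

Lemma qbinom_small (R : comNzRingType) (q : R) (m i : nat) :
  (m < i)%N -> qbinom q m i = 0.
Proof.
elim: m i => [|m IH] [|i] //= lt_mi.
by rewrite !IH ?mulr0 ?addr0 // ltnW.
Qed.

Lemma qbinomn (R : comNzRingType) (q : R) (m : nat) : qbinom q m m = 1.
Proof.
by elim: m => [|m IH] //; rewrite qbinomS IH qbinom_small // mulr0 addr0.
Qed.

(** The absorption identity stands in for the quotient formula for Gaussian
    binomials: being free of division, it may be evaluated at a root of
    unity. *)
Lemma mul_qbinom (R : comNzRingType) (q : R) (m i : nat) :
  (1 - q ^+ i.+1) * qbinom q m.+1 i.+1 = (1 - q ^+ m.+1) * qbinom q m i.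
Proof.
elim: m i => [|m IH] [|i].
- by rewrite /= mulr0 addr0.
- by rewrite /= !mulr0 addr0 mulr0.
- rewrite qbinomS mulrDr mulrCA IH !qbinom0 !exprS expr0; ring.
rewrite qbinomS mulrDr mulrCA (IH i.+1).
(* 1 - q^(i+2) = (1 - q) + q (1 - q^(i+1)), so the induction hypothesis at i
   applies to the first summand too. *)
have -> : (1 - q ^+ i.+2) * qbinom q m.+1 i.+1
        = (1 - q) * qbinom q m.+1 i.+1 + q * ((1 - q ^+ m.+1) * qbinom q m i).
  by rewrite -IH (exprS q i.+1); ring.
rewrite qbinomS !(exprS q); ring.
Qed.

(** Absorption at m + 1 = n has right-hand side 0, while the factor 1 - q^i on
    the left is nonzero because i is less than the order of q. *)
Lemma qbinom_prim_root (R : idomainType) (q : R) (n i : nat) :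
  n.-primitive_root q -> (0 < i < n)%N -> qbinom q n i = 0.
Proof.
case: n i => [|n] [|i] // prim_q /andP[_ lt_in].
have /eqP := mul_qbinom q n i.
rewrite (prim_expr_order prim_q) subrr mul0r mulf_eq0 => /orP[|/eqP //].
rewrite subr_eq0 eq_sym -(prim_order_dvd prim_q) => /dvdn_leq -/(_ isT).
by rewrite leqNgt lt_in.
Qed.

Lemma qcomm_exprr (R : comNzRingType) (B : algType R) (q : R) (x y : B) i :
  x * y = q *: (y * x) -> x * y ^+ i = q ^+ i *: (y ^+ i * x).
Proof.
move=> xy; elim: i => [|i IH]; first by rewrite !expr0 scale1r mulr1 mul1r.
rewrite !(exprS y) mulrA xy -scalerAl -[y * x * _]mulrA IH -scalerAr scalerA.
by rewrite mulrA -!exprS.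
Qed.

(** Multiplying the expansion of order m on the left by y raises the power of y
    by one, and by x costs a factor q^i to pass y^i; collecting y^(i+1) gives
    exactly the recursion that defines the coefficients. *)
Lemma qbinomial (R : comNzRingType) (B : algType R) (q : R) (x y : B) m :
  x * y = q *: (y * x) ->
  (x + y) ^+ m = \sum_(i < m.+1) qbinom q m i *: (y ^+ i * x ^+ (m - i)).
Proof.
move=> xy; elim: m => [|m IH]; first by rewrite big_ord1 scale1r !expr0 mulr1.
rewrite exprS IH mulrDl !mulr_sumr addrC [RHS]big_ord_recl.
rewrite subn0 qbinom0 expr0 scale1r mul1r.
under [X in _ = _ + X]eq_bigr => i _ do rewrite lift0 subSS qbinomS scalerDl.
rewrite big_split /= addrCA; congr (_ + _).
  by apply: eq_bigr => i _; rewrite -scalerAr mulrA exprS.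
rewrite big_ord_recl big_ord_recr.
rewrite [in X in _ = _ + (_ + X)]qbinom_small // mulr0 scale0r addr0.
congr (_ + _); first by rewrite qbinom0 scale1r expr0 mul1r subn0 exprS.
apply: eq_bigr => i _; rewrite lift0.
rewrite -scalerAr mulrA (qcomm_exprr _ xy) -scalerAl scalerA -mulrA -exprS.
by rewrite subnSK // mulrC.
Qed.

(** The two extreme terms are all that remains of the q-binomial expansion. *)
Lemma exprDn_qcomm (R : idomainType) (B : algType R) (q : R) (x y : B) n :
  n.-primitive_root q -> x * y = q *: (y * x) ->
  (x + y) ^+ n = x ^+ n + y ^+ n.
Proof.
move=> prim_q xy; rewrite (qbinomial _ xy).
case: n prim_q => [//|n] prim_q.
rewrite big_ord_recl big_ord_recr /= big1 => [|i _].
  rewrite -[bump 0 n]/(n.+1) subnn !expr0 mulr1 mul1r add0r scale1r.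
  by rewrite -/(qbinom q n.+1 n.+1) qbinomn scale1r.
by rewrite -/(qbinom q n.+1 i.+1) (qbinom_prim_root prim_q) ?scale0r //= ltnS.
Qed.

(** The last element q-commutes with the sum of the earlier ones, so additivity
    on pairs peels off one summand at a time. *)
Lemma expr_sum_qcomm (R : idomainType) (B : algType R) (q : R) (z : nat -> B)
    (n a b : nat) :
  n.-primitive_root q ->
  (forall i j, (a <= i)%N -> (i < j)%N -> (j < b)%N ->
     z i * z j = q *: (z j * z i)) ->
  (\sum_(a <= i < b) z i) ^+ n = \sum_(a <= i < b) z i ^+ n.
Proof.
move=> prim_q; elim: b => [|b IH] zz.
  by rewrite !big_geq // expr0n gtn_eqF // (prim_order_gt0 prim_q).
have [le_ab|lt_ba] := leqP a b; last first.
  by rewrite !big_geq // expr0n gtn_eqF // (prim_order_gt0 prim_q).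
rewrite !big_nat_recr //= (exprDn_qcomm prim_q) ?IH // => [i j ai ij jb|].
  by apply: zz => //; apply: ltnW.
rewrite mulr_suml mulr_sumr scaler_sumr.
by apply: eq_big_nat => i /andP[ai ib]; apply: zz.
Qed.

(** A defect of q-commutation between x and y can be repaired by sharing an
    intermediate element c between them: the product of the two shares
    contributes a b c^2 on one side and q a b c^2 on the other, and the
    difference a b (1 - q) c^2 makes up for the defect. *)
Lemma qcommD_defect (R : comNzRingType) (B : algType R) (q a b : R)
    (x c y : B) :
  x * c = q *: (c * x) -> c * y = q *: (y * c) ->
  x * y = q *: (y * x) - (a * b * (1 - q)) *: c ^+ 2 ->
  (x + a *: c) * (b *: c + y) = q *: ((b *: c + y) * (x + a *: c)).
Proof.
move=> xc cy xy.
rewrite !mulrDl !mulrDr -!scalerAl -!scalerAr xc cy xy -expr2.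
rewrite !scalerDr !scalerA [b * q]mulrC [a * q]mulrC.
have -> : (a * b) *: c ^+ 2
        = (a * b * (1 - q)) *: c ^+ 2 + (q * b * a) *: c ^+ 2.
  by rewrite -scalerDl; congr (_ *: _); ring.
rewrite [X in X + _ = _]addrA -[X in _ + X = _]addrA [LHS]addrA.
by rewrite subrK addrACA.
Qed.

Theorem proposition2p1 (F : closedFieldType) (charF0 : [pchar F] =i pred0)
    (B : algType F) (q gamma1 gamma2 gamma : F)
    (gammaE : gamma = gamma1 * gamma2 * (1 - q))
    (k : nat) (k_ge1 : (1 <= k)%N) (z w : nat -> B)
    (zz : forall i j : nat, (1 <= i)%N -> (i < j)%N -> (j <= 2 * k + 1)%N ->
       z i * z j = if (i + j == 2 * k + 2)%N then q *: (z j * z i) + w i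
                   else q *: (z j * z i))
    (sum_w : \sum_(1 <= i < k.+1) w i = - (gamma *: z k.+1 ^+ 2)) :
  u_elt gamma1 k z * v_elt gamma2 k z
    = q *: (v_elt gamma2 k z * u_elt gamma1 k z)
  /\ (forall n : nat, n.-primitive_root q -> gamma1 + gamma2 = 1 ->
      (\sum_(1 <= i < (2 * k + 1).+1) z i) ^+ n
        = \sum_(1 <= i < k.+1) z i ^+ n
          + (gamma1 ^+ n + gamma2 ^+ n) *: z k.+1 ^+ n
          + \sum_(k.+2 <= i < (2 * k + 1).+1) z i ^+ n).
Proof.
have zz_low i j : (1 <= i)%N -> (i < j)%N -> (j < k.+2)%N ->
    z i * z j = q *: (z j * z i).
  by move=> i1 ij jk; rewrite zz ?ifF //; lia.
have zz_high i j : (k.+1 <= i)%N -> (i < j)%N -> (j < (2 * k + 1).+1)%N ->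
    z i * z j = q *: (z j * z i).
  by move=> i1 ij jk; rewrite zz ?ifF //; lia.
rewrite /u_elt /v_elt.
set S := \sum_(1 <= i < k.+1) z i; set T := \sum_(k.+2 <= i < _) z i.
set c := z k.+1.
have Sc : S * c = q *: (c * S).
  rewrite mulr_suml mulr_sumr scaler_sumr.
  by apply: eq_big_nat => i /andP[i1 ik]; apply: zz_low.
have cT : c * T = q *: (T * c).
  rewrite mulr_suml mulr_sumr scaler_sumr.
  by apply: eq_big_nat => i /andP[i1 ik]; apply: zz_high.
have ST : S * T = q *: (T * S) - gamma *: c ^+ 2.
  rewrite -sum_w [S * T]mulr_suml [T * S]mulr_sumr scaler_sumr -big_split /=.
  apply: eq_big_nat => i /andP[i1 ik].
  rewrite mulr_sumr mulr_suml scaler_sumr.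
  (* w i is collected from the single index j = 2k+2-i of the range of T. *)
  have -> : w i = \sum_(k.+2 <= j < (2 * k + 1).+1)
                    (if (j == 2 * k + 2 - i)%N then w i else 0).
    by rewrite -big_mkcond big_nat1_eq ifT //; lia.
  rewrite -big_split /=; apply: eq_big_nat => j /andP[j1 jk].
  rewrite zz //; try lia.
  have -> : (j == 2 * k + 2 - i)%N = (i + j == 2 * k + 2)%N by lia.
  by case: ifP; rewrite ?addr0.
have uv : (S + gamma1 *: c) * (gamma2 *: c + T)
        = q *: ((gamma2 *: c + T) * (S + gamma1 *: c)).
  by apply: qcommD_defect; rewrite // -gammaE.
split=> // n prim_q g12.
have -> : \sum_(1 <= i < (2 * k + 1).+1) z i
        = (S + gamma1 *: c) + (gamma2 *: c + T).
  rewrite (big_cat_nat (n := k.+1)) //=; last by lia.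
  rewrite [X in _ + X]big_ltn; last by lia.
  by rewrite -addrA [gamma1 *: c + _]addrA -scalerDl g12 scale1r.
rewrite (exprDn_qcomm prim_q uv).
rewrite (exprDn_qcomm prim_q (x := S)); last first.
  by rewrite -scalerAr Sc -scalerAl !scalerA mulrC.
rewrite (exprDn_qcomm prim_q (y := T)); last first.
  by rewrite -scalerAl cT -scalerAr !scalerA mulrC.
rewrite !exprZn (expr_sum_qcomm prim_q (z := z)); last first.
  by move=> i j i1 ij jk; apply: zz_low => //; apply: ltnW.
rewrite (expr_sum_qcomm prim_q (z := z)); last first.
  by move=> i j i1 ij jk; apply: zz_high => //; apply: ltnW.
by rewrite scalerDl !addrA.
Qed.
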